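(* Let $\mu\in\mathcal P$ and $n\in\mathbb N$. There exists a best $d_{\sf L}$-approximation $\delta_\bullet^{\bullet,n}$ of $\mu$, and $d_{\sf L}(\mu,\delta_\bullet^{\bullet,n})=\omega\,{\sf L}_\bullet^{\bullet,n}$. Moreover, for every $x\in\Xi_n$ and $p\in\Pi_n$, the following are equivalent: (i) $d_{\sf L}(\mu,\delta_x^p)=d_{\sf L}(\mu,\delta_\bullet^{\bullet,n})$; (ii) for every $j=0,\ldots,n$: $x_j<x_{j+1}\ \Longrightarrow\ \ell_{F_\mu,[x_j,x_{j+1}]}(P_j)\le{\sf L}_\bullet^{\bullet,n}$; (iii) for every $j=1,\ldots,n$: $P_{j-1}<P_j\ \Longrightarrow\ \ell_{F_\mu^{-1},[P_{j-1},P_j]}(x_j)\le{\sf L}_\bullet^{\bullet,n}$.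
   Context: $\mathbb I\subset\mathbb R$ is a compact interval with Lebesgue measure $\lambda(\mathbb I)>0$, and $\mathcal P$ is the set of all Borel probability measures on $\mathbb I$. For $\mu\in\mathcal P$, $F_\mu(x)=\mu(\{y\in\mathbb I:y\le x\})$, $x\in\mathbb R$. Let $\omega=\max\{1,\lambda(\mathbb I)\}/\lambda(\mathbb I)$. The (normalized) Lévy distance is $$d_{\sf L}(\mu,\nu)=\omega\inf\{y\ge0: F_\mu(\cdot-y)-y\le F_\nu\le F_\mu(\cdot+y)+y\}.$$ For $n\in\mathbb N$: $\Xi_n=\{x\in\mathbb I^n:x_1\le\ldots\le x_n\}$, with $x_0:=-\infty$, $x_{n+1}:=+\infty$; $\Pi_n=\{p\in\mathbb R^n:p_j\ge0,\ \sum_{j=1}^np_j=1\}$, with $P_i=\sum_{j=1}^ip_j$ for $i=0,\ldots,n$ (so $P_0=0$, $P_n=1$); $\delta_x^p=\sum_{j=1}^np_j\delta_{x_j}$, where $\delta_a$ is the Dirac measure at $a$. A best $d_{\sf L}$-approximation of $\mu$ (for given $n$), denoted $\delta_\bullet^{\bullet,n}$, is a measure $\delta_x^p$ with $x\in\Xi_n$, $p\in\Pi_n$ such that $d_{\sf L}(\mu,\delta_x^p)\le d_{\sf L}(\mu,\delta_y^q)$ for all $y\in\Xi_n$, $q\in\Pi_n$. For non-decreasing $f:\mathbb R\to\overline{\mathbb R}=\mathbb R\cup\{\pm\infty\}$, put $f_\pm(x)=\lim_{\varepsilon\downarrow0}f(x\pm\varepsilon)$ for $x\in\mathbb R$, $f_\pm(\pm\infty)=f(\pm\infty):=\lim_{x\to\pm\infty}f(x)$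 (same sign for the argument and the limit), and let $f^{-1}:\mathbb R\to\overline{\mathbb R}$, $f^{-1}(t)=\sup\{x\in\mathbb R:f(x)\le t\}$, with $\sup\varnothing=-\infty$ (and $f^{-1}(\pm\infty)=\lim_{t\to\pm\infty}f^{-1}(t)$). In particular $F_\mu^{-1}:\mathbb R\to\overline{\mathbb R}$ equals $-\infty$ on $]-\infty,0[$ and $+\infty$ on $[1,+\infty[$. For an interval $J\subset\overline{\mathbb R}$ with $f_-(\sup J)<+\infty$ and $-f_+(\inf J)<+\infty$, define for $x\in\mathbb R$ $$\ell_{f,J}(x)=\inf\{y\ge0: f_-(\sup J-y)-y\le x\le f_+(\inf J+y)+y\}$$ (well-defined for $f=F_\mu$ and every $J$, and for $f=F_\mu^{-1}$ and $J\subset[0,1]$). For $a\ge0$ let $T_{f,a}:\overline{\mathbb R}\to\overline{\mathbb R}$, $T_{f,a}(x)=f_+(f^{-1}(x+a)+2a)+a$, let $T_{f,a}^{[n]}$ be its $n$-fold composition with itself, and let $${\sf L}_\bullet^{\bullet,n}=\min\{a\ge0:T_{F_\mu,a}^{[n]}(0)\ge1\}$$ (this minimum exists and is finite). *)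

(* Defs.v *)
From HB Require Import structures.
From mathcomp Require Import all_boot all_order all_algebra.
From mathcomp Require Import all_classical all_reals all_analysis.

Set Implicit Arguments.
Unset Strict Implicit.
Unset Printing Implicit Defensive.

Import Order.TTheory GRing.Theory Num.Theory.
Import numFieldNormedType.Exports.

Local Open Scope classical_set_scope.
Local Open Scope ring_scope.

Section monotone_functions.
Context {R : realType}.
Implicit Types (f : R -> \bar R) (x : \bar R).

(* All limits below exist when f is non-decreasing. *)
Definition extend f x : \bar R :=
  match x with
  | EFin r => f r
  | +oo%E => lim (f y @[y --> +oo%R])
  | -oo%E => lim (f y @[y --> -oo%R])
  end.

Definition rlim f x : \bar R :=
  if x is EFin r then lim (f y @[y --> r^'+]) else extend f x.

Definition llim f x : \bar R :=
  if x is EFin r then lim (f y @[y --> r^'-]) else extend f x.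

Definition upper_inv f (t : R) : \bar R :=
  ereal_sup [set z%:E | z in [set z : R | (f z <= t%:E)%E]].

(* The infimum is taken in \bar R, so that it is +oo if no y qualifies; for
   the f and J of interest some y does and ell f J x is finite. *)
Definition ell f (J : set (\bar R)) (x : R) : \bar R :=
  ereal_inf [set y%:E | y in [set y : R | 0 <= y /\
    (llim f (ereal_sup J - y%:E) - y%:E <= x%:E
       <= rlim f (ereal_inf J + y%:E) + y%:E)%E]].

Definition Tmap f (a : R) (x : \bar R) : \bar R :=
  (rlim f (extend (upper_inv f) (x + a%:E) + (2 * a)%:E) + a%:E)%E.

End monotone_functions.

Section levy.
Context {R : realType}.
(* The compact interval is `[a, b]. *)
Variables a b : R.

(* A Borel probability measure on `[a, b] is represented by a Borel
   probability measure on R giving mass 1 to `[a, b]. *)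
Definition is_prob_on (mu : probability (measurableTypeR R) R) : Prop :=
  mu `[a, b]%classic = 1%E.

Definition omega : R :=
  let len := fine (lebesgue_measure (`[a, b] : set R)) in Num.max 1 len / len.

(* Measures enter only through their values on sets, so the definitions below
   are stated for set functions; see weighted_dirac_probability for the
   discrete measures. *)
Definition Fdist (mu : set R -> \bar R) (x : R) : \bar R :=
  mu [set y | y \in `[a, b] /\ y <= x].

Definition dLevy (mu nu : set R -> \bar R) : \bar R :=
  (omega%:E * ereal_inf [set y%:E | y in [set y : R | (0 <= y)%R /\
     forall x : R, Fdist mu (x - y)%R - y%:E <= Fdist nu x
                     <= Fdist mu (x + y)%R + y%:E]])%E.

Definition locations n (x : 'I_n -> R) : Prop :=
  (forall i, x i \in `[a, b]) /\ (forall i j : 'I_n, (i <= j)%N -> x i <= x j).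

Definition weights n (p : 'I_n -> R) : Prop :=
  (forall i, 0 <= p i) /\ \sum_i p i = 1.

(* Ordinals start at 0: the mathematical x_j is x at the ordinal j - 1, with
   x_0 = -oo, and x_j = +oo for j > n. *)
Definition xpt n (x : 'I_n -> R) (j : nat) : \bar R :=
  if j is k.+1 then if insub k is Some i then (x i)%:E else +oo%E
  else -oo%E.

(* P_i = p_1 + ... + p_i, with 1-based indices. *)
Definition psum n (p : 'I_n -> R) (i : nat) : R := \sum_(j < n | (j < i)%N) p j.

Definition weighted_dirac n (x p : 'I_n -> R) (A : set R) : \bar R :=
  (\sum_(j < n) (p j)%:E * dirac (x j : measurableTypeR R) A)%E.

Definition best_approx n (mu delta : set R -> \bar R) : Prop :=
  (exists x p : 'I_n -> R,
     [/\ locations x, weights p & delta = weighted_dirac x p]) /\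
  (forall y q : 'I_n -> R, locations y -> weights q ->
     (dLevy mu delta <= dLevy mu (weighted_dirac y q))%E).

(* The least element of a set of reals (a default value if there is none). *)
Definition least (S : set R) : R := get [set c | S c /\ lbound S c].

Definition Lopt n (mu : set R -> \bar R) : R :=
  least [set c : R | 0 <= c /\ (1%:E <= iter n (Tmap (Fdist mu) c) 0%:E)%E].

Lemma weighted_dirac_probability n (x p : 'I_n -> R) :
  locations x -> weights p ->
  exists2 nu : probability (measurableTypeR R) R,
    is_prob_on nu & weighted_dirac x p = nu.
Proof.
move=> [xI _] [p_ge0 p_sum].
have wI (A : set R) : A = setT \/ A = `[a, b]%classic -> weighted_dirac x p A = 1%E.
  move=> hA; rewrite /weighted_dirac (eq_bigr (fun j => (p j)%:E)).
    by rewrite sumEFin p_sum.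
  move=> j _; rewrite diracE mem_set ?mule1//.
  by case: hA => ->; [|exact: xI].
pose m k : {measure set (measurableTypeR R) -> \bar R} :=
  if insub k is Some j
  then mscale (NngNum (p_ge0 j)) (dirac (x j : measurableTypeR R))
  else mzero.
have wE : weighted_dirac x p = msum m n.
  apply/funext => A; rewrite /weighted_dirac /msum; apply: eq_bigr => j _.
  by rewrite /m valK.
have wT : msum m n setT = 1%E by rewrite -wE; apply: wI; left.
pose H := Measure_isProbability.Build _ _ _ (msum m n) wT.
pose nu : probability (measurableTypeR R) R := HB.pack (msum m n) H.
exists nu; last exact: wE.
by rewrite /is_prob_on /= -wE; apply: wI; right.
Qed.

End levy.

(* Main.v *)
Require Import Defs.
From mathcomp Require Import all_boot all_order all_algebra.
From mathcomp Require Import all_classical all_reals all_analysis.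
From mathcomp Require Import lra zify.
Import Order.TTheory GRing.Theory Num.Theory.
Import numFieldNormedType.Exports.

(** The value of the Levy distance is governed by one elementary condition.
    Write [F] for the distribution function of [mu], [x_i] for the atoms and
    [P_i] for the partial sums of the weights.  The measure [delta_x^p] is
    within (unnormalized) Levy distance [c] of [mu] if and only if, for every
    atom [x_i], the vertical segment from [P_(i-1)] to [P_i] above [x_i] lies in
    the band of width [c] around the graph of [F]:
      [F_-(x_i - c) - c <= P_(i-1)]  and  [P_i <= F(x_i + c) + c].
    This is [fits] below.

    Condition (ii) says that the horizontal steps of positive length of the
    discrete distribution function stay in the band.  Every real [z] belongs to
    exactly one such step, so (ii) gives back the Levy inequalities at all [z]
    ([gaps_ok_levy_close]).  Condition (iii) looks at the vertical jumps of
    positive height, read in the inverse function: by the Galois connection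
    between [F] and [F^-1], its two inequalities for an atom are the two
    inequalities above.  An atom without jump takes over its inequalities from
    its neighbours by monotonicity ([jumps_okP]).

    As for the optimal value, [fits] says [x_i - c <= F^-1(P_(i-1) + c)] and
    [P_i <= F(x_i + c) + c], hence [P_i <= T_c(P_(i-1))]: the map [T_c] bounds
    the level that one more atom can reach.  So [n] atoms can climb from 0 to
    1 within the band only if the n-th iterate of [T_c] at 0 is at least 1
    ([fits_iter_levy_step]), and the greedy choice of atoms, clamped to the
    interval and to the level 1, shows that this suffices
    ([iter_levy_step_fits]).  The set of admissible [c] contains 1 and its
    infimum, since [T_c(t)] is monotone and jointly right-continuous in [(c, t)]
    ([levy_step_rc]).  So the least value exists, and the greedy atoms for it
    form a best approximation. *)

Set Implicit Arguments.
Unset Strict Implicit.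
Unset Printing Implicit Defensive.

Local Open Scope classical_set_scope.
Local Open Scope ring_scope.

(** * One-sided limits of monotone functions *)

Section monotone.
Context {R : realType}.
Variable f : R -> \bar R.
Hypothesis f_nd : {homo f : x y / x <= y >-> (x <= y)%E}.

Lemma rlimE (r : \bar R) : r != +oo%E ->
  rlim f r = ereal_inf [set f z | z in [set z | r < z%:E]]%E.
Proof.
case: r => [r| //|] _ /=; apply/cvg_lim => //.
  rewrite (_ : [set z | _] = [set` Interval (BRight r) +oo%O])%E.
    by apply: nondecreasing_at_right_cvge => // x y _ _; exact: f_nd.
  by apply/seteqP; split => z /=; rewrite lte_fin in_itv/= andbT.
rewrite (_ : [set f z | z in _] = range (f \o -%R)).
  by apply/cvgNy_compNP/nonincreasing_cvge => x y xy; rewrite f_nd// lerN2.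
apply/seteqP; split => _ [z _ <-] /=; last by exists (- z); rewrite //= ltNyr.
by exists (- z); rewrite //= opprK.
Qed.

Lemma llimE (s : \bar R) : s != -oo%E ->
  llim f s = ereal_sup [set f z | z in [set z | z%:E < s]]%E.
Proof.
case: s => [s| |//] _ /=; apply/cvg_lim => //.
  apply/cvg_at_leftNP.
  rewrite (_ : [set f z | z in _] =
               (f \o -%R) @` [set` Interval (BRight (- s)) +oo%O]).
    apply: nonincreasing_at_right_cvge => // x y _ _ xy.
    by rewrite f_nd// lerN2.
  apply/seteqP; split => _ [z /= + <-].
    rewrite lte_fin => zs; exists (- z); rewrite /= ?opprK//.
    by rewrite in_itv/= ltrN2 zs.
  by rewrite in_itv/= andbT => zs; exists (- z) => //=; rewrite lte_fin ltrNl.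
rewrite (_ : [set z | _] = setT)%E; first exact: nondecreasing_cvge.
by apply/seteqP; split => z //= _; rewrite ltry.
Qed.

Lemma le_rlim (t r : \bar R) : r != +oo%E ->
  (t <= rlim f r)%E <-> forall z, (r < z%:E)%E -> (t <= f z)%E.
Proof.
move=> roo; rewrite rlimE//; split => [/ereal_infP h z rz|h].
  by apply: h; exists z.
by apply/ereal_infP => _ [z rz <-]; exact: h.
Qed.

Lemma llim_le (t s : \bar R) : s != -oo%E ->
  (llim f s <= t)%E <-> forall z, (z%:E < s)%E -> (f z <= t)%E.
Proof.
move=> soo; rewrite llimE//; split => [/ereal_supP h z rz|h].
  by apply: h; exists z.
by apply/ereal_supP => _ [z rz <-]; exact: h.
Qed.

End monotone.

(** * The two inequalities in the definition of [ell] *)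

Lemma ereal_sup_cc (R : realType) (u v : \bar R) : (u <= v)%E ->
  ereal_sup [set` `[u, v]] = v.
Proof.
move=> uv; apply: le_anti; apply/andP; split.
  by apply/ereal_supP => y /=; rewrite in_itv/= => /andP[].
by apply: ereal_sup_ubound; rewrite /= in_itv/= uv lexx.
Qed.

Lemma ereal_inf_cc (R : realType) (u v : \bar R) : (u <= v)%E ->
  ereal_inf [set` `[u, v]] = u.
Proof.
move=> uv; apply: le_anti; apply/andP; split.
  by apply: ereal_inf_lbound; rewrite /= in_itv/= uv lexx.
by apply/ereal_infP => y /=; rewrite in_itv/= => /andP[].
Qed.

Section bands.
Context {R : realType}.
Variable f : R -> \bar R.

(** This is [f_-(s - y) - y <= x], with the left limit spelled out so that no
    arithmetic of infinite values is left. *)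
Definition lower_band (s : \bar R) (x y : R) :=
  forall z, (z%:E < s)%E -> (f (z - y) <= (x + y)%:E)%E.

(** This is [x <= f_+(r + y) + y]. *)
Definition upper_band (r : \bar R) (x y : R) :=
  forall z, (r < z%:E)%E -> ((x - y)%:E <= f (z + y))%E.

Hypothesis f_nd : {homo f : x y / x <= y >-> (x <= y)%E}.

(** The set of admissible [y] contains its infimum because moving [z] up to
    some [z' < s] compensates a small increase of [y]. *)
Lemma lower_band_closed s x y :
  (forall e, 0 < e -> exists2 y', y' < y + e & lower_band s x y') ->
  lower_band s x y.
Proof.
move=> h z zs; have [z' zz' z's] : exists2 z', z < z' & (z'%:E < s)%E.
  case: s zs {h} => [s| |//]; last by exists (z + 1); rewrite ?ltry ?ltrDl.
  rewrite lte_fin => zs; exists ((z + s) / 2); rewrite ?lte_fin; lra.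
apply/lee_addgt0Pr => e e0.
have [|y' + hy'] := h (Num.min e (z' - z)).
  by rewrite lt_min e0 subr_gt0.
rewrite -ltrBlDl lt_min => /andP[y'e y'z].
apply: (le_trans (y := f (z' - y'))); first by apply: f_nd; lra.
by apply: (le_trans (hy' _ z's)); rewrite -EFinD lee_fin; lra.
Qed.

Lemma upper_band_closed r x y :
  (forall e, 0 < e -> exists2 y', y' < y + e & upper_band r x y') ->
  upper_band r x y.
Proof.
move=> h z zr; have [z' zz' z'r] : exists2 z', z' < z & (r < z'%:E)%E.
  case: r zr {h} => [r| //|]; last by exists (z - 1); rewrite ?ltNyr ?gtrBl.
  rewrite lte_fin => zr; exists ((z + r) / 2); rewrite ?lte_fin; lra.
apply/lee_addgt0Pr => e e0.
have [|y' + hy'] := h (Num.min e (z - z')).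
  by rewrite lt_min e0 subr_gt0.
rewrite -ltrBlDl lt_min => /andP[y'e y'z].
rewrite -leeBlDr// -EFinB.
apply: (le_trans (y := f (z' + y'))); last by apply: f_nd; lra.
by apply: (le_trans _ (hy' _ z'r)); rewrite lee_fin; lra.
Qed.

Lemma bandsE (s r : \bar R) (x y : R) : s != -oo%E -> r != +oo%E ->
  (llim f (s - y%:E) - y%:E <= x%:E <= rlim f (r + y%:E) + y%:E)%E
  <-> lower_band s x y /\ upper_band r x y.
Proof.
move=> soo roo.
have -> : (llim f (s - y%:E) - y%:E <= x%:E <= rlim f (r + y%:E) + y%:E)%E
  = (llim f (s - y%:E) <= (x + y)%:E)%E && ((x - y)%:E <= rlim f (r + y%:E))%E.
  by congr andb; [rewrite leeBlDr | rewrite EFinB leeBlDr].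
rewrite -(rwP andP) llim_le ?le_rlim//; last 2 first.
- by case: r roo.
- by case: s soo.
split=> -[h1 h2]; split=> z hz.
- by apply: h1; rewrite lteBrDr// -EFinD subrK.
- by apply: h2; rewrite EFinD lteD2rE.
- by rewrite -[z](addrK y); apply: h1; rewrite EFinD -lteBrDr.
- by rewrite -[z](subrK y); apply: h2; rewrite EFinB lteBrDr.
Qed.

Lemma ell_cc_le (u v : \bar R) (x c : R) : (u < v)%E -> 0 <= c ->
  (ell f [set` `[u, v]] x <= c%:E)%E <-> lower_band v x c /\ upper_band u x c.
Proof.
move=> uv c0; have voo : v != -oo%E by rewrite gt_eqF// (le_lt_trans _ uv) ?leNye.
have uoo : u != +oo%E by rewrite lt_eqF// (lt_le_trans uv) ?leey.
rewrite /ell ereal_sup_cc ?ereal_inf_cc ?(ltW uv)//; split => [ell_c|h]; last first.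
  by apply: ereal_inf_lbound; exists c => //=; split => //; exact/bandsE.
have adh e : 0 < e -> exists2 y, y < c + e &
    lower_band v x y /\ upper_band u x y.
  move=> e0; have ce : (c%:E < (c + e)%:E)%E by rewrite lte_fin ltrDl.
  have /ereal_inf_lt[_ [y [y0 hy] <-]] := le_lt_trans ell_c ce.
  by rewrite lte_fin => yce; exists y => //; exact/bandsE.
by split; [apply: lower_band_closed|apply: upper_band_closed] => e /adh[y ? []];
  exists y.
Qed.

End bands.

(** * The inverse of a monotone function *)

Section upper_inverse.
Context {R : realType}.
Variable f : R -> \bar R.

Lemma upper_inv_nd : {homo upper_inv f : t u / t <= u >-> (t <= u)%E}.
Proof.
move=> t u tu; apply: ereal_sup_le => _ [w /= wt <-]; exists w => //=.
by rewrite (le_trans wt)// lee_fin.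
Qed.

Lemma upper_inv_le (x t : R) :
  (upper_inv f t <= x%:E)%E <-> forall z, x < z -> (t%:E < f z)%E.
Proof.
split=> [tx z xz|h].
  rewrite ltNge; apply/negP => fz.
  have : (z%:E <= upper_inv f t)%E by apply: ereal_sup_ubound; exists z.
  by move=> /le_trans/(_ tx); rewrite lee_fin leNgt xz.
apply/ereal_supP => _ [w /= wt <-]; rewrite lee_fin leNgt.
by apply/negP => /h; rewrite ltNge wt.
Qed.

Hypothesis f_nd : {homo f : x y / x <= y >-> (x <= y)%E}.

(** The Galois connection [x <= f^-1(t)] iff [f_-(x) <= t]. *)
Lemma le_upper_inv (x t : R) :
  (x%:E <= upper_inv f t)%E <-> forall z, z < x -> (f z <= t%:E)%E.
Proof.
split=> [xt z zx|h].
  have : (z%:E < upper_inv f t)%E by rewrite (lt_le_trans _ xt)// lte_fin.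
  move=> /ereal_sup_gt[_ [w /= wt <-]]; rewrite lte_fin => zw.
  by apply: le_trans wt; apply: f_nd; exact: ltW.
apply/lee_subgt0Pr => e e0; apply: ereal_sup_ubound.
by exists (x - e) => //=; apply: h; rewrite gtrBl.
Qed.

End upper_inverse.

(** * Distribution functions on a compact interval *)

(** For a nondecreasing function, [distr_rc] is right continuity; this form is
    the one that passes to the inverse function and to iterates. *)
Record distribution_on (R : realType) (a b : R) (F : R -> R) : Prop :=
  Distribution {
  distr_nd : forall x y, x <= y -> F x <= F y;
  distr_rc : forall x v, F x < v -> exists2 e : R, 0 < e & F (x + e) < v;
  distr_lta : forall x, x < a -> F x = 0;
  distr_geb : forall x, b <= x -> F x = 1 }.

Section distribution_function.
Context {R : realType}.
Variables (a b : R) (mu : probability (measurableTypeR R) R).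
Hypothesis muP : is_prob_on a b mu.

Let E (x : R) : set (measurableTypeR R) := [set y | y \in `[a, b] /\ y <= x].

Let mE x : measurable (E x).
Proof.
rewrite (_ : E x = `[a, b] `&` `]-oo, x])%classic; first exact: measurableI.
by apply/seteqP; split => y /=; rewrite [_ \in `]-oo, x]]in_itv/=.
Qed.

Lemma FdistE : Fdist a b mu = EFin \o (fine \o Fdist a b mu).
Proof.
by apply/funext => x; rewrite /= fineK//; apply: fin_num_measure; exact: mE.
Qed.

Let FE x : mu (E x) = (fine (Fdist a b mu x))%:E.
Proof. exact: (congr1 (@^~ x) FdistE). Qed.

Lemma Fdist_distribution : distribution_on a b (fine \o Fdist a b mu).
Proof.
split=> [x y xy|x v /= Fv|x xa|x bx] /=.
- rewrite -lee_fin -!FE; apply: le_measure; rewrite ?inE//.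
  by move=> z [zab zx]; split => //; exact: le_trans xy.
- apply: contrapT => /forall2NP h.
  (* right continuity is continuity of [mu] along the sets [E (x + 1/(k+1))] *)
  pose u k := E (x + k.+1%:R^-1).
  have uE : \bigcap_k u k = E x.
    apply/seteqP; split => [y uy|y [yab yx] k _]; last first.
      by split => //; rewrite (le_trans yx)// lerDl.
    split; first exact: (uy 0%N I).1.
    rewrite leNgt; apply/negP => /ltr_add_invr[k]; rewrite ltNge.
    by rewrite (uy k I).2.
  have : mu \o u @ \oo --> mu (\bigcap_k u k).
    apply: nonincreasing_cvg_mu => //.
    + by rewrite (le_lt_trans (probability_le1 _ _)) ?ltry//; exact: mE.
    + by move=> k; exact: mE.
    + by rewrite uE; exact: mE.
    move=> i j ij; apply/subsetPset => y [yab yx]; split => //.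
    by rewrite (le_trans yx)// lerD2l lef_pV2 ?posrE// ler_nat.
  rewrite uE FE => cu.
  suff : (v%:E <= (fine (Fdist a b mu x))%:E)%E by rewrite lee_fin leNgt Fv.
  apply: cvge_ge cu; apply: nearW => k; rewrite /= /u FE lee_fin leNgt.
  by apply/negP; have [|//] := h k.+1%:R^-1.
- apply: EFin_inj; rewrite -FE (_ : E x = set0) ?measure0//.
  apply/seteqP; split => // y [/itvP yab yx].
  by have := lt_le_trans xa (le_trans _ yx); rewrite ltxx yab => /(_ isT).
- apply: EFin_inj; rewrite -FE -[RHS]muP; congr (mu _).
  apply/seteqP; split => y /= => [[]//|yab]; split => //.
  by rewrite (le_trans _ bx)// (itvP yab).
Qed.

End distribution_function.

Definition quantile {R : realType} (f : R -> \bar R) (t : R) : R :=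
  fine (upper_inv f t).

Section distribution.
Context {R : realType}.
Variables (a b : R) (F : R -> R).
Hypothesis FP : distribution_on a b F.
Implicit Types (c t u v x p : R).
Local Notation f := (EFin \o F).
Local Notation G := (quantile f).

Let F_nd := distr_nd FP.
Let F_rc := distr_rc FP.

Lemma distr_ge0 x : 0 <= F x.
Proof.
have [/(distr_lta FP)->//|ax] := ltP x a.
rewrite -(distr_lta FP (_ : a - 1 < a)) ?gtrBl//.
by apply: F_nd; lra.
Qed.

Lemma distr_le1 x : F x <= 1.
Proof.
have [/(distr_geb FP)->//|xb] := leP b x.
by rewrite -(distr_geb FP (lexx b)) F_nd// ltW.
Qed.

Lemma distr_EFin_nd : {homo f : x y / x <= y >-> (x <= y)%E}.
Proof. by move=> x y /F_nd; rewrite lee_fin. Qed.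

Let f_nd := distr_EFin_nd.

Lemma lower_bandE x p c :
  lower_band f x%:E p c <-> forall z, z < x -> F (z - c) <= p + c.
Proof. by split=> h z /h; rewrite lee_fin. Qed.

Lemma upper_bandE x p c : upper_band f x%:E p c <-> p - c <= F (x + c).
Proof.
split=> [h|h z]; last first.
  rewrite lte_fin => xz; rewrite lee_fin (le_trans h)// F_nd// lerD2r.
  exact: ltW.
rewrite leNgt; apply/negP => /F_rc[e e0]; rewrite ltNge => /negP; apply.
by rewrite -lee_fin addrAC; apply: h; rewrite lte_fin; lra.
Qed.

(** Passing to the inverse function exchanges the two sides of the band.  In this
    case, the left limit of [F^-1] at [p - c] is at most [x + c] if and only if
    [p - c <= F(x + c)], by right continuity of [F]. *)
Lemma lower_band_upper_inv x p c :
  lower_band (upper_inv f) p%:E x c <-> upper_band f x%:E p c.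
Proof.
rewrite upper_bandE; split=> h.
  rewrite leNgt; apply/negP => /F_rc[e e0 Fe].
  have := h (F (x + c + e) + c); rewrite lte_fin -ltrBrDr => /(_ Fe).
  rewrite addrK => /upper_inv_le/(_ (x + c + e)).
  by rewrite ltrDl ltxx => /(_ e0).
move=> z; rewrite lte_fin => zp; apply/upper_inv_le => w xw.
by have := F_nd (ltW xw); rewrite lte_fin; lra.
Qed.

Lemma upper_band_upper_inv x p c :
  upper_band (upper_inv f) p%:E x c <-> lower_band f x%:E p c.
Proof.
split=> h z; rewrite lte_fin => zx; last first.
  apply/(le_upper_inv f_nd) => w wx; have := h (w + c).
  by rewrite lte_fin addrK => /(_ _)/le_trans; apply; rewrite ?lee_fin; lra.
apply/lee_addgt0Pr => e e0; have := h (p + e).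
rewrite lte_fin ltrDl => /(_ e0)/(le_upper_inv f_nd)/(_ (z - c)).
by rewrite -EFinD !lee_fin addrAC; apply; lra.
Qed.

Lemma upper_inv_ge1 t : 1 <= t -> upper_inv f t = +oo%E.
Proof.
move=> t1; apply/eqyP => x _; apply/(le_upper_inv f_nd) => z _.
by rewrite lee_fin (le_trans (distr_le1 _)).
Qed.

Lemma upper_inv_fin t : 0 <= t < 1 ->
  [/\ upper_inv f t = (G t)%:E, a <= G t & G t <= b].
Proof.
move=> /andP[t0 t1].
have Gb : (upper_inv f t <= b%:E)%E.
  by apply/upper_inv_le => z /ltW/(distr_geb FP) /= ->; rewrite lte_fin.
have Ga : (a%:E <= upper_inv f t)%E.
  by apply/(le_upper_inv f_nd) => z /(distr_lta FP) /= ->; rewrite lee_fin.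
have GE : upper_inv f t = (G t)%:E.
  rewrite /quantile fineK// fin_numElt (lt_le_trans _ Ga) ?ltNyr//=.
  by rewrite (le_lt_trans Gb) ?ltry.
by move: Ga Gb; rewrite GE !lee_fin.
Qed.

Lemma le_distr_quantile t : 0 <= t < 1 -> t <= F (G t).
Proof.
move=> t01; rewrite leNgt; apply/negP => /F_rc[e e0 Fe].
have [GE _ _] := upper_inv_fin t01.
suff : ((G t)%:E < upper_inv f t)%E by rewrite GE ltxx.
apply: (@lt_le_trans _ _ (G t + e)%:E); first by rewrite lte_fin ltrDl.
by apply: ereal_sup_ubound; exists (G t + e) => //=; rewrite lee_fin ltW.
Qed.

Lemma quantile_nd t u : 0 <= t -> t <= u -> u < 1 -> G t <= G u.
Proof.
move=> t0 tu u1; have := upper_inv_nd f tu.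
have [|-> _ _] := @upper_inv_fin t; first by rewrite t0 (le_lt_trans tu).
have [|-> _ _] := @upper_inv_fin u; first by rewrite (le_trans t0).
by rewrite lee_fin.
Qed.

Lemma rlim_distr x : rlim f x%:E = f x.
Proof.
apply: le_anti; apply/andP; split; last first.
  by apply/(le_rlim f_nd) => // z; rewrite lte_fin => /ltW/F_nd.
rewrite (rlimE f_nd)//; apply/lee_addgt0Pr => e e0.
have [|d d0 Fd] := @F_rc x (F x + e); first by rewrite ltrDl.
apply: (le_trans (y := f (x + d))); last by rewrite -EFinD lee_fin ltW.
by apply: ereal_inf_lbound; exists (x + d) => //=; rewrite lte_fin ltrDl.
Qed.

(** * The iterated map and its least admissible parameter *)

(** The restriction of [T_c] to the arguments [t >= - c], where its values are
    finite: when [t + c >= 1], the inverse function is infinite and the limit of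
    [F] there is 1. *)
Definition levy_step (c t : R) : R :=
  if t + c < 1 then F (G (t + c) + 2 * c) + c else 1 + c.

Lemma TmapE c t : 0 <= t + c -> Tmap f c t%:E = (levy_step c t)%:E.
Proof.
move=> tc0; rewrite /Tmap /levy_step -EFinD /=; case: ltP => tc1.
  have [|-> _ _] := @upper_inv_fin (t + c); first by rewrite tc0.
  by rewrite -EFinD rlim_distr -EFinD.
rewrite upper_inv_ge1// addye// EFinD; congr (_ + _)%E.
apply/cvg_lim => //; apply: cvg_near_cst.
by near=> z; rewrite /= (distr_geb FP)//; near: z; exact: nbhs_pinfty_ge.
Unshelve. all: by end_near. Qed.

Lemma levy_step_nd c c' t t' : 0 <= t + c -> c <= c' -> t <= t' ->
  levy_step c t <= levy_step c' t'.
Proof.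
move=> tc0 cc tt; rewrite /levy_step.
case: (ltP (t + c)) => tc; case: (ltP (t' + c')) => tc'; try lra.
- have := quantile_nd tc0 (lerD tt cc) tc' => Gle.
  have : G (t + c) + 2 * c <= G (t' + c') + 2 * c' by lra.
  by move=> /F_nd; lra.
- have := distr_le1 (G (t + c) + 2 * c); lra.
Qed.

Lemma levy_step_ge0 c t : 0 <= c -> 0 <= levy_step c t.
Proof.
move=> c0; rewrite /levy_step; case: ifP => _; last by rewrite addr_ge0.
by rewrite addr_ge0// distr_ge0.
Qed.

Lemma le_levy_step c t : 0 <= c -> 0 <= t -> t <= 1 -> t <= levy_step c t.
Proof.
move=> c0 t0 t1; rewrite /levy_step; case: (ltP (t + c)) => tc; last lra.
have := @le_distr_quantile (t + c) ltac:(lra).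
have : G (t + c) <= G (t + c) + 2 * c by lra.
by move=> /F_nd; lra.
Qed.

(** The joint right continuity of [T_c(t)].  An upper bound [G(s) <= z] with
    [s < F(z)] survives a small increase of [s], so the inverse function is
    right-continuous, and so is [F]. *)
Lemma levy_step_rc c t v : 0 <= t + c -> levy_step c t < v ->
  exists2 d : R, 0 < d & levy_step (c + d) (t + d) < v.
Proof.
move=> tc0; rewrite {1}/levy_step; case: (ltP (t + c) 1) => tc Tv; last first.
  exists ((v - 1 - c) / 2); first lra.
  by rewrite /levy_step ifF; [lra|apply/negP/negP; rewrite -leNgt; lra].
set g := G _ in Tv.
have [|e e0 Fe] := @F_rc (g + 2 * c) (v - c); first lra.
have [GE _ _] := @upper_inv_fin (t + c) ltac:(lra).
have : (upper_inv f (t + c) <= g%:E)%E by rewrite GE.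
move=> /upper_inv_le/(_ (g + e / 2)); rewrite lte_fin => /(_ ltac:(lra)) tF.
(* the four bounds on [m] keep the argument of [F] below [g + 2c + e], the value
   below [v], the argument of [G] below [F (g + e/2)], and that argument below
   1 *)
pose m := Num.min (e / 4) (Num.min ((v - c - F (g + 2 * c + e)) / 2)
  (Num.min ((F (g + e / 2) - (t + c)) / 4) ((1 - (t + c)) / 4))).
have m0 : 0 < m by rewrite !lt_min; apply/and4P; split; lra.
have : m <= m by []; rewrite {2}/m !le_min => /and4P[m1 m2 m3 m4].
exists m => //; rewrite /levy_step ifT; last lra.
have [GE' _ _] := @upper_inv_fin (t + m + (c + m)) ltac:(lra).
have Gle : G (t + m + (c + m)) <= g + e / 2.
  rewrite -lee_fin -GE'; apply/upper_inv_le => z /ltW/F_nd gz.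
  by rewrite lte_fin; lra.
have : G (t + m + (c + m)) + 2 * (c + m) <= g + 2 * c + e by lra.
by move=> /F_nd; lra.
Qed.

Lemma iter_levy_step_ge0 c k : 0 <= c -> 0 <= iter k (levy_step c) 0.
Proof. by move=> c0; case: k => //= k; exact: levy_step_ge0. Qed.

Lemma iter_TmapE c k : 0 <= c ->
  iter k (Tmap f c) 0%:E = (iter k (levy_step c) 0)%:E.
Proof.
move=> c0; elim: k => //= k ->.
by rewrite TmapE// addr_ge0// iter_levy_step_ge0.
Qed.

Lemma iter_levy_step_nd c c' k : 0 <= c -> c <= c' ->
  iter k (levy_step c) 0 <= iter k (levy_step c') 0.
Proof.
move=> c0 cc'; elim: k => //= k IH; apply: levy_step_nd => //.
by rewrite addr_ge0// iter_levy_step_ge0.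
Qed.

Lemma iter_levy_step_rc c k v : 0 <= c -> iter k (levy_step c) 0 < v ->
  exists2 d : R, 0 < d & iter k (levy_step (c + d)) 0 < v.
Proof.
move=> c0; elim: k v => [|k IH] v; first by exists 1.
rewrite iterS => /levy_step_rc[|d d0 Td].
  by rewrite addr_ge0// iter_levy_step_ge0.
have [|d' d'0 Td'] := IH (iter k (levy_step c) 0 + d); first by rewrite ltrDl.
have m0 : 0 < Num.min d d' by rewrite lt_min d0.
exists (Num.min d d') => //; rewrite iterS; apply: le_lt_trans Td.
have cm : 0 <= c + Num.min d d' by lra.
apply: levy_step_nd; first by rewrite addr_ge0// iter_levy_step_ge0.
  by rewrite lerD2l ge_min lexx.
apply: le_trans (ltW Td'); apply: iter_levy_step_nd => //.
by rewrite lerD2l ge_min lexx orbT.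
Qed.

Lemma levy_step_least n : (0 < n)%N ->
  let S := [set c : R | 0 <= c /\ (1%:E <= iter n (Tmap f c) 0%:E)%E] in
  S (least S) /\ lbound S (least S).
Proof.
move=> n0 S; apply: (@getPex _ [set c | S c /\ lbound S c]).
have SE c : S c <-> 0 <= c /\ 1 <= iter n (levy_step c) 0.
  by rewrite /S/=; split=> -[c0]; rewrite iter_TmapE// lee_fin.
have S1 : S 1.
  apply/SE; split => //; case: n n0 {S SE} => // k _; rewrite iterS.
  have := iter_levy_step_ge0 k ler01 => h.
  by rewrite /levy_step ifF; [lra|apply/negP/negP; rewrite -leNgt; lra].
have S0 : lbound S 0 by move=> c [].
have Slb : has_lbound S by exists 0.
have Si : has_inf S by split => //; exists 1.
have i0 : 0 <= inf S by apply: lb_le_inf => //; exists 1.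
exists (inf S); split; last by move=> c Sc; exact: ge_inf.
apply/SE; split => //; rewrite leNgt; apply/negP => /(iter_levy_step_rc i0)[d d0].
have [c /SE[c0 Sc] cd] := inf_adherent d0 Si.
by apply/negP; rewrite -leNgt (le_trans Sc)// iter_levy_step_nd// ltW.
Qed.

(** * Climbing inside the band with one atom *)

(** The lower inequality puts [x - c] below [F^-1(t + c)], hence [F(x + c) + c]
    below [T_c(t)]. *)
Lemma band_le_levy_step c t x p : 0 <= t + c ->
  lower_band f x%:E t c -> upper_band f x%:E p c -> p <= levy_step c t.
Proof.
move=> tc0 /lower_bandE lo /upper_bandE up.
rewrite /levy_step; case: (ltP (t + c)) => tc.
  have [GE _ _] := @upper_inv_fin (t + c) ltac:(lra).
  have : ((x - c)%:E <= upper_inv f (t + c))%E.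
    apply/(le_upper_inv f_nd) => z zx; rewrite lee_fin.
    by rewrite -[z](addrK c); apply: lo; lra.
  rewrite GE lee_fin => xG.
  have : x + c <= G (t + c) + 2 * c by lra.
  by move=> /F_nd; lra.
have := distr_le1 (x + c); lra.
Qed.

(** The rightmost position in the interval at which an atom above the level [t]
    still satisfies the lower inequality. *)
Definition levy_atom (c t : R) : R :=
  if t + c < 1 then Num.min b (G (t + c) + c) else b.

Lemma levy_atom_itv c t : a < b -> 0 <= c -> 0 <= t -> levy_atom c t \in `[a, b].
Proof.
move=> ab c0 t0; rewrite /levy_atom in_itv/=.
case: (ltP (t + c)) => tc; last by rewrite lexx ltW.
have [_ Ga Gb] := @upper_inv_fin (t + c) ltac:(lra).
by rewrite le_min ge_min lexx/= andbT; apply/andP; split; lra.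
Qed.

Lemma levy_atom_nd c t u : 0 <= t + c -> t <= u -> levy_atom c t <= levy_atom c u.
Proof.
move=> tc0 tu; rewrite /levy_atom.
case: (ltP (t + c)) => tc; case: (ltP (u + c)) => uc; try lra.
  have tuc : t + c <= u + c by lra.
  have Gle := quantile_nd tc0 tuc uc.
  by rewrite le_min ge_min lexx/= ge_min lerD2r Gle orbT.
by rewrite ge_min lexx.
Qed.

Lemma levy_atom_band c t p : 0 <= c -> 0 <= t -> p <= 1 -> p <= levy_step c t ->
  lower_band f (levy_atom c t)%:E t c /\ upper_band f (levy_atom c t)%:E p c.
Proof.
move=> c0 t0 p1; rewrite lower_bandE upper_bandE /levy_atom /levy_step.
have Fbc : F (b + c) = 1 by apply: (distr_geb FP); lra.
case: (ltP (t + c)) => tc pT; last first.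
  by split=> [z _|]; [have := distr_le1 (z - c); lra|rewrite Fbc; lra].
have [GE _ _] := @upper_inv_fin (t + c) ltac:(lra).
have : ((G (t + c))%:E <= upper_inv f (t + c))%E by rewrite GE.
move=> /(le_upper_inv f_nd) FG; split=> [z|].
  by rewrite lt_min => /andP[_ zG]; rewrite -lee_fin; apply: FG; lra.
case: (leP b (G (t + c) + c)) => _; first by rewrite Fbc; lra.
by rewrite (_ : G (t + c) + c + c = G (t + c) + 2 * c); lra.
Qed.

End distribution.

(** * Partial sums of the weights *)

Lemma ler_sum_cond (R : numDomainType) (I : finType) (A B : pred I) (p : I -> R) :
  (forall i, 0 <= p i) -> (forall i, A i -> B i) ->
  \sum_(i | A i) p i <= \sum_(i | B i) p i.
Proof.
move=> p0 AB; rewrite big_mkcond [leRHS]big_mkcond; apply: ler_sum => i _.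
by case: ifP => [/AB ->|_]//; case: ifP.
Qed.

Section psum_theory.
Context {R : realType} {n : nat}.
Implicit Types p : 'I_n -> R.

Lemma psum0 p : psum p 0 = 0.
Proof. exact: big_pred0. Qed.

Lemma psumS p (i : 'I_n) : psum p i.+1 = psum p i + p i.
Proof.
rewrite /psum (bigD1 i)//= addrC; congr (_ + _); apply: eq_bigl => j.
by rewrite ltnS ltn_neqAle -val_eqE andbC.
Qed.

Lemma psum_last p : psum p n = \sum_i p i.
Proof. by apply: eq_bigl => i; rewrite ltn_ord. Qed.

Lemma weights_psum_last p : weights p -> psum p n = 1.
Proof. by rewrite psum_last => -[]. Qed.

Lemma psum_nd p i j : (forall k, 0 <= p k) -> (i <= j)%N -> psum p i <= psum p j.
Proof. by move=> p0 ij; apply: ler_sum_cond => // k ki; exact: leq_trans ij. Qed.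

Lemma psum_ge0 p i : (forall k, 0 <= p k) -> 0 <= psum p i.
Proof. by move=> p0; exact: sumr_ge0. Qed.

Lemma psum_telescope (u : nat -> R) k : (k <= n)%N ->
  psum (fun i : 'I_n => u i.+1 - u i) k = u k - u 0%N.
Proof.
elim: k => [|k IH] kn; first by rewrite psum0 subrr.
by rewrite (psumS _ (Ordinal kn))/= IH 1?ltnW// addrC subrKA.
Qed.

End psum_theory.

(** * Discrete measures in the band *)

Section xpt_theory.
Context {R : realType} {n : nat}.
Implicit Type x : 'I_n -> R.

Lemma xpt_ord x (i : 'I_n) : xpt x i.+1 = (x i)%:E.
Proof. by rewrite /= valK. Qed.

Lemma xpt_last x : xpt x n.+1 = +oo%E.
Proof. by rewrite /= insubN// ltnn. Qed.

End xpt_theory.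

Section discrete.
Context {R : realType}.
Variables (a b : R) (n : nat) (x p : 'I_n -> R).

(** Geometrically, the vertical segments of the graph of the discrete distribution
    function lie in the Levy band of width [c] around the graph of [F]. *)
Definition fits (F : R -> R) (c : R) := forall i : 'I_n,
  lower_band (EFin \o F) (x i)%:E (psum p i) c /\
  upper_band (EFin \o F) (x i)%:E (psum p i.+1) c.

Definition levy_close (F : R -> R) (c : R) := forall z,
  F (z - c) - c <= \sum_(j | x j <= z) p j <= F (z + c) + c.

Definition gaps_ok (F : R -> R) (c : R) :=
  forall j, (j <= n)%N -> (xpt x j < xpt x j.+1)%E ->
  lower_band (EFin \o F) (xpt x j.+1) (psum p j) c /\
  upper_band (EFin \o F) (xpt x j) (psum p j) c.

Definition jumps_ok (F : R -> R) (c : R) :=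
  forall j : 'I_n, psum p j < psum p j.+1 ->
  lower_band (upper_inv (EFin \o F)) (psum p j.+1)%:E (x j) c /\
  upper_band (upper_inv (EFin \o F)) (psum p j)%:E (x j) c.

Hypotheses (xP : locations a b x) (pP : weights p).

Let p_ge0 : forall i, 0 <= p i := pP.1.

Lemma Fdist_weighted_dirac z :
  Fdist a b (weighted_dirac x p) z = (\sum_(j | x j <= z) p j)%:E.
Proof.
rewrite /Fdist /weighted_dirac -sumEFin [RHS]big_mkcond.
apply: eq_bigr => j _; rewrite diracE; case: ifP => xz.
  by rewrite mem_set ?mule1//; split => //; exact: xP.1.
by rewrite memNset ?mule0// => -[_]; rewrite xz.
Qed.

Lemma split_point z :
  exists2 k, (k <= n)%N & forall i : 'I_n, (x i <= z) = (i < k)%N.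
Proof.
pose Q k := [forall i : 'I_n, (k <= i)%N ==> (z < x i)].
have Qn : exists k, Q k.
  by exists n; apply/forallP => i; rewrite leqNgt ltn_ord.
have [k /forallP Qk kmin] := ex_minnP Qn; exists k.
  by apply: kmin; apply/forallP => i; rewrite leqNgt ltn_ord.
move=> i; rewrite leNgt ltnNge; congr (~~ _); apply/idP/idP => [zx|].
  apply: kmin; apply/forallP => j; apply/implyP => ij.
  by rewrite (lt_le_trans zx)// xP.2.
exact/implyP.
Qed.

Lemma xpt_split_point z k :
  (k <= n)%N -> (forall i : 'I_n, (x i <= z) = (i < k)%N) ->
  (xpt x k <= z%:E < xpt x k.+1)%E.
Proof.
move=> kn kP; apply/andP; split.
  case: k kn kP => [|k] kn kP; first by rewrite leNye.
  by rewrite (xpt_ord _ (Ordinal kn)) lee_fin kP/=.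
move: kn; rewrite leq_eqVlt => /predU1P[->|kn]; first by rewrite xpt_last ltry.
by rewrite (xpt_ord _ (Ordinal kn)) lte_fin ltNge kP/= ltnn.
Qed.

Variable F : R -> R.
Hypothesis FP : distribution_on a b F.
Variable c : R.
Hypothesis c_ge0 : 0 <= c.

Let F_nd := distr_nd FP.

Lemma levy_close_fits : levy_close F c -> fits F c.
Proof.
move=> h i; rewrite (upper_bandE FP) lower_bandE; split=> [z zx|].
  have /andP[+ _] := h z; rewrite lerBlDr => /le_trans; apply; rewrite lerD2r.
  apply: ler_sum_cond => // j xz; rewrite ltnNge; apply/negP => /(xP.2 _ _).
  by move=> /(lt_le_trans zx)/(le_lt_trans xz); rewrite ltxx.
have /andP[_] := h (x i); rewrite lerBlDr; apply: le_trans.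
by apply: ler_sum_cond => // j; rewrite ltnS; exact: xP.2.
Qed.

Lemma fits_gaps_ok : fits F c -> gaps_ok F c.
Proof.
move=> h j jn _; split.
  move: jn; rewrite leq_eqVlt => /predU1P[->|jn].
    move=> z _; rewrite lee_fin (weights_psum_last pP).
    by rewrite (le_trans (distr_le1 FP _))// lerDl.
  by rewrite (xpt_ord _ (Ordinal jn)); exact: (h (Ordinal jn)).1.
case: j jn => [|j] jn.
  move=> z _; rewrite lee_fin psum0 sub0r (le_trans _ (distr_ge0 FP _))//.
  by rewrite oppr_le0.
by rewrite (xpt_ord _ (Ordinal jn)); exact: (h (Ordinal jn)).2.
Qed.

Lemma gaps_ok_levy_close : gaps_ok F c -> levy_close F c.
Proof.
move=> h z; have [k kn kP] := split_point z.
have /andP[xz zx] := xpt_split_point kn kP.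
have [lo up] := h k kn (le_lt_trans xz zx).
rewrite (eq_bigl _ _ kP) -/(psum p k); apply/andP; split.
  by rewrite lerBlDr -lee_fin; exact: lo.
case: k kn xz up {kP zx lo} => [|k] kn.
  by rewrite psum0 addr_ge0// (distr_ge0 FP).
rewrite (xpt_ord _ (Ordinal kn)) lee_fin => xz /(upper_bandE FP).
by rewrite lerBlDr => /le_trans; apply; rewrite lerD2r F_nd// lerD2r.
Qed.

Lemma levy_closeP : levy_close F c <-> fits F c.
Proof.
by split=> [|/fits_gaps_ok/gaps_ok_levy_close]; first exact: levy_close_fits.
Qed.

Lemma gaps_okP : gaps_ok F c <-> fits F c.
Proof.
by split=> [/gaps_ok_levy_close/levy_close_fits|]; last exact: fits_gaps_ok.
Qed.

(** Where the level does not jump, the inequalities are taken over from a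
    neighbouring atom: the upper one from the previous atom and the lower one
    from the next atom.  At the ends, the levels 0 and 1 make them trivial. *)
Lemma jumps_okP : jumps_ok F c <-> fits F c.
Proof.
split=> h; last first.
  move=> j _; rewrite (lower_band_upper_inv FP) (upper_band_upper_inv FP).
  by rewrite and_comm.
have {}h (j : 'I_n) : psum p j < psum p j.+1 ->
    lower_band (EFin \o F) (x j)%:E (psum p j) c /\
    upper_band (EFin \o F) (x j)%:E (psum p j.+1) c.
  move=> /h; rewrite (lower_band_upper_inv FP) (upper_band_upper_inv FP).
  by rewrite and_comm.
have flat (j : 'I_n) : ~~ (psum p j < psum p j.+1) -> psum p j.+1 = psum p j.
  by rewrite -leNgt => jj; apply: le_anti; rewrite jj; exact: psum_nd.
move=> i; split.
  have [m mE] := ubnP (n - i); elim: m i mE => // m IH i mE.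
  have [/h[]//|/flat iE] := boolP (psum p i < psum p i.+1).
  move: (ltn_ord i); rewrite leq_eqVlt => /predU1P[iN|iN].
    move=> z _; rewrite lee_fin -iE iN (weights_psum_last pP).
    by rewrite (le_trans (distr_le1 FP _))// lerDl.
  have /IH/= : (n - Ordinal iN < m)%N by rewrite /=; lia.
  rewrite iE !lower_bandE => lo z zx; apply: lo; apply: lt_le_trans zx _.
  exact: xP.2.
case: i => k; elim: k => [|k IH] kn; set i := Ordinal kn.
  have [/h[]//|/flat iE] := boolP (psum p i < psum p i.+1).
  rewrite (upper_bandE FP) iE/= psum0 sub0r (le_trans _ (distr_ge0 FP _))//.
  by rewrite oppr_le0.
have [/h[]//|/flat iE] := boolP (psum p i < psum p i.+1).
have := IH (ltnW kn); rewrite iE !(upper_bandE FP)/= => /le_trans; apply.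
by rewrite F_nd// lerD2r xP.2.
Qed.

End discrete.

Section levy_distance.
Context {R : realType}.
Variables (a b : R) (n : nat) (x p : 'I_n -> R) (F : R -> R) (c : R).
Hypotheses (xP : locations a b x) (pP : weights p).
Hypotheses (FP : distribution_on a b F) (c_ge0 : 0 <= c).

Lemma ereal_inf_levy_close :
  (ereal_inf [set y%:E | y in [set y : R | (0 <= y)%R /\ levy_close x p F y]]
     <= c%:E)%E <-> fits x p F c.
Proof.
split=> [le_c|/(levy_closeP xP pP FP c_ge0) hc]; last first.
  by apply: ereal_inf_lbound; exists c.
have adh e : 0 < e -> exists2 y, y < c + e & fits x p F y.
  move=> e0; have ce : (c%:E < (c + e)%:E)%E by rewrite lte_fin ltrDl.
  have /ereal_inf_lt[_ [y [y0 hy] <-]] := le_lt_trans le_c ce.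
  by rewrite lte_fin => yc; exists y => //; exact/(levy_closeP xP pP FP y0).
move=> i; split; [apply: lower_band_closed|apply: upper_band_closed];
  by [exact: distr_EFin_nd FP | move=> e /adh[y yc /(_ i)[]]; exists y].
Qed.

Lemma fits_iter_levy_step : fits x p F c -> 1 <= iter n (levy_step F c) 0.
Proof.
move=> h; rewrite -(weights_psum_last pP).
suff : forall k, (k <= n)%N -> psum p k <= iter k (levy_step F c) 0 by apply.
elim=> [|k IH] kn; first by rewrite psum0.
have [lo up] := h (Ordinal kn).
have pk0 : 0 <= psum p k by apply: psum_ge0; exact: pP.1.
have pc0 : 0 <= psum p k + c by rewrite addr_ge0.
apply: le_trans (band_le_levy_step FP pc0 lo up) _.
by apply: (levy_step_nd FP) => //; exact: IH (ltnW kn).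
Qed.

End levy_distance.

(** The greedy construction: each atom is placed as far to the right as the
    lower inequality allows, and the level after it is raised as far as the upper
    inequality allows. *)
Lemma iter_levy_step_fits (R : realType) (a b : R) (F : R -> R) (n : nat) (c : R) :
  a < b -> distribution_on a b F -> 0 <= c -> 1 <= iter n (levy_step F c) 0 ->
  exists x p : 'I_n -> R, [/\ locations a b x, weights p & fits x p F c].
Proof.
move=> ab FP c0 T1.
pose u k := iter k (levy_step F c) 0.
have u0 k : 0 <= u k by exact: (iter_levy_step_ge0 FP).
pose P k := Num.min 1 (u k).
have P0 : P 0%N = 0 by rewrite /P min_r// ler01.
have P1 : P n = 1 by rewrite /P min_l.
have P_ge0 k : 0 <= P k by rewrite le_min ler01 u0.
have P_le1 k : P k <= 1 by rewrite ge_min lexx.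
have Pstep k : P k.+1 <= levy_step F c (P k).
  rewrite {2}/P; case: (leP 1 (u k)) => uk; last by rewrite /P ge_min lexx orbT.
  by rewrite (le_trans (P_le1 _))// (le_levy_step FP)// ler01.
have Pnd k : P k <= P k.+1.
  rewrite le_min P_le1/=; apply: (@le_trans _ _ (levy_step F c (P k))).
    exact: (le_levy_step FP).
  apply: (levy_step_nd FP) => //; first by rewrite addr_ge0.
  by rewrite /P ge_min lexx orbT.
have Pmono := homo_leq (@lexx _ _) (@le_trans _ _) Pnd.
pose x (i : 'I_n) := levy_atom b F c (P i).
pose p (i : 'I_n) := P i.+1 - P i.
have pE k : (k <= n)%N -> psum p k = P k.
  by move=> kn; rewrite (psum_telescope P)// P0 subr0.
exists x, p; split.
- split=> [i|i j ij]; first exact: (levy_atom_itv FP).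
  by apply: (levy_atom_nd FP); [rewrite addr_ge0|exact: Pmono].
- by split=> [i|]; [rewrite subr_ge0|rewrite -psum_last pE].
- move=> i; rewrite !pE//; last exact: ltnW.
  exact: (levy_atom_band FP).
Qed.

Lemma omega_gt0 (R : realType) (a b : R) : a < b -> 0 < omega a b.
Proof.
move=> ab; rewrite /omega lebesgue_measure_itv/= lte_fin ab -EFinB/=.
by rewrite divr_gt0 ?subr_gt0// lt_max ltr01.
Qed.

(** * Best approximations *)

Theorem theorem3p12 (R : realType) (a b : R) (hab : a < b)
    (mu : probability (measurableTypeR R) R) (hmu : is_prob_on a b mu)
    (n : nat) (hn : (0 < n)%N) :
  (exists delta : set R -> \bar R, best_approx a b n mu delta) /\
  (forall delta : set R -> \bar R, best_approx a b n mu delta ->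
     dLevy a b mu delta = (omega a b * Lopt a b n mu)%:E /\
     forall x p : 'I_n -> R, locations a b x -> weights p ->
       let cond_i :=
         dLevy a b mu (weighted_dirac x p) = dLevy a b mu delta in
       let cond_ii :=
         forall j : nat, (j <= n)%N -> (xpt x j < xpt x j.+1)%E ->
           (ell (Fdist a b mu) [set` `[xpt x j, xpt x j.+1]] (psum p j)
              <= (Lopt a b n mu)%:E)%E in
       let cond_iii :=
         forall j : 'I_n, psum p j < psum p j.+1 ->
           (ell (upper_inv (Fdist a b mu))
                [set` `[(psum p j)%:E, (psum p j.+1)%:E]] (x j)
              <= (Lopt a b n mu)%:E)%E in
       (cond_i <-> cond_ii) /\ (cond_i <-> cond_iii)).
Proof.
have FE := FdistE a b mu; have FP := Fdist_distribution hmu.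
set L := Lopt a b n mu.
set F := (fine \o _) in FE FP; clearbody F.
have w0 : 0 < omega a b by exact: omega_gt0.
have [[L0 TL] Lmin] :
    (0 <= L /\ (1%:E <= iter n (Tmap (EFin \o F) L) 0%:E)%E) /\
    lbound [set c : R | 0 <= c /\ (1%:E <= iter n (Tmap (EFin \o F) c) 0%:E)%E] L.
  by rewrite /L /Lopt FE; exact: (levy_step_least FP hn).
have dE (x p : 'I_n -> R) : locations a b x ->
    dLevy a b mu (weighted_dirac x p) = ((omega a b)%:E * ereal_inf
      [set y%:E | y in [set y : R | (0 <= y)%R /\ levy_close x p F y]])%E.
  move=> xP; rewrite /dLevy; congr (_ * ereal_inf [set y%:E | y in _])%E.
  by apply/seteqP; split => y /= [y0 h]; split => // z; have := h z;
    rewrite FE Fdist_weighted_dirac.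
have d_le (x p : 'I_n -> R) : locations a b x -> weights p ->
    (dLevy a b mu (weighted_dirac x p) <= (omega a b * L)%:E)%E <-> fits x p F L.
  move=> xP pP; rewrite dE// (EFinM _ L) lee_pmul2l ?fin_numE// ?lte_fin//.
  exact: (ereal_inf_levy_close xP).
have d_ge (x p : 'I_n -> R) : locations a b x -> weights p ->
    ((omega a b * L)%:E <= dLevy a b mu (weighted_dirac x p))%E.
  move=> xP pP; rewrite dE// (EFinM _ L) lee_pmul2l ?fin_numE// ?lte_fin//.
  apply/ereal_infP => _ [y [y0 /(levy_close_fits xP pP FP)hy] <-].
  rewrite lee_fin; apply: Lmin; split => //; rewrite (iter_TmapE FP)// lee_fin.
  exact: (fits_iter_levy_step pP FP y0 hy).
have [x0 [p0 [x0P p0P fit0]]] :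
    exists x p : 'I_n -> R, [/\ locations a b x, weights p & fits x p F L].
  by apply: iter_levy_step_fits => //; rewrite (iter_TmapE FP)// lee_fin in TL.
have d0 : dLevy a b mu (weighted_dirac x0 p0) = (omega a b * L)%:E.
  by apply: le_anti; rewrite d_ge// andbT; exact/d_le.
split.
  exists (weighted_dirac x0 p0).
  by split=> [|y q yP qP]; [exists x0, p0|rewrite d0; exact: d_ge].
move=> delta [[x1 [p1 [x1P p1P ->]]] best1].
have d1 : dLevy a b mu (weighted_dirac x1 p1) = (omega a b * L)%:E.
  by apply: le_anti; rewrite d_ge// andbT -d0; exact: best1.
split => // x p xP pP; rewrite d1 /=.
have fitsP :
    dLevy a b mu (weighted_dirac x p) = (omega a b * L)%:E <-> fits x p F L.
  rewrite -d_le//; split=> [->//|le_d].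
  by apply: le_anti; rewrite le_d d_ge.
rewrite FE fitsP; split.
  rewrite -(gaps_okP xP pP FP L0).
  by split=> h j jn xj; have := h j jn xj;
    rewrite (ell_cc_le (distr_EFin_nd FP)).
rewrite -(jumps_okP xP pP FP L0).
by split=> h j pj; have := h j pj;
  rewrite (ell_cc_le (upper_inv_nd _)) ?lte_fin.
Qed.
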